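(* Let $p\in(0,1)$ and let $(G_t)_{t\ge 1}$ be the preferential attachment random graph process with edge-step of parameter $p$. For every $\varepsilon>0$, asymptotically almost surely the graph $G_{2t}$ has a complete subgraph of order $t^{\alpha}$, where $\alpha=(1-\varepsilon)\frac{1-p}{2-p}$; that is, $$\lim_{t\to\infty}\mathbb{P}\left(G_{2t}\text{ contains a complete subgraph with at least } t^{(1-\varepsilon)\frac{1-p}{2-p}}\text{ vertices}\right)=1 .$$
   Context: The process. Graphs are multigraphs (loops and multiple edges allowed), and a loop contributes $2$ to the degree of its vertex. Let $(Z_t)_{t\ge1}$ be i.i.d. Bernoulli random variables with $\mathbb{P}(Z_t=1)=p$. $G_1$ is the graph with one vertex and one loop. Given $G_t$, the graph $G_{t+1}$ is obtained as follows. If $Z_t=1$, perform a vertex-step: add a new vertex $v$ and an edge $\{u,v\}$, where $u$ is a vertex of $G_t$ chosen with probability proportional to its degree in $G_t$. If $Z_t=0$, perform an edge-step: add a new edge $\{u_1,u_2\}$, where $u_1,u_2$ are vertices of $G_t$ chosen independently, each with probability proportional to its degree in $G_t$ (so $u_1=u_2$ is possible, giving a loop, and an edge may be added between already adjacent vertices). All choices are independent of $(Z_t)$ given the current graph. Thus $G_t$ has $t$ edges and total degree $2t$. A complete subgraph of order $n$ in a multigraph is a set of $n$ vertices any two distinct of which are joined by at least one edge. *)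

(* Defs.v *)
From HB Require Import structures.
From mathcomp Require Import all_boot all_order all_algebra.
From mathcomp Require Import all_classical all_reals all_analysis.

Set Implicit Arguments.
Unset Strict Implicit.
Unset Printing Implicit Defensive.

Import Order.TTheory GRing.Theory Num.Theory.
Import numFieldNormedType.Exports.

Local Open Scope classical_set_scope.
Local Open Scope ring_scope.

(* Finite labelled multigraphs: the vertices are 0, ..., nverts - 1, in order
   of appearance, and edges lists the edges with repetition, also in order of
   appearance.  An edge is an unordered pair, stored as (min, max); a loop at
   v is (v, v). *)
Record multigraph := Multigraph {
  nverts : nat;
  edges : seq (nat * nat)
}.

Definition multigraph_pair (g : multigraph) := (nverts g, edges g).
Definition pair_multigraph (x : nat * seq (nat * nat)) := Multigraph x.1 x.2.

Lemma multigraph_pairK : cancel multigraph_pair pair_multigraph.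
Proof. by case. Qed.

HB.instance Definition _ := Countable.copy multigraph (can_type multigraph_pairK).

Definition upair (u v : nat) : nat * nat := (minn u v, maxn u v).

(* A loop (v, v) contributes 2. *)
Definition degree (g : multigraph) (v : nat) : nat :=
  (\sum_(e <- edges g) ((e.1 == v) + (e.2 == v)))%N.

Definition total_degree (g : multigraph) : nat :=
  (\sum_(v < nverts g) degree g v)%N.

Definition complete_subgraph (g : multigraph) (S : {set 'I_(nverts g)}) : Prop :=
  forall u v, u \in S -> v \in S -> u != v -> upair u v \in edges g.

Definition has_complete_subgraph (R : realType) (g : multigraph) (x : R) : Prop :=
  exists S : {set 'I_(nverts g)}, complete_subgraph S /\ x <= #|S|%:R.

Definition loop_graph : multigraph := Multigraph 1 [:: upair 0 0].

Definition vertex_step (g : multigraph) (u : nat) : multigraph :=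
  Multigraph (nverts g).+1 (rcons (edges g) (upair u (nverts g))).

Definition edge_step (g : multigraph) (u1 u2 : nat) : multigraph :=
  Multigraph (nverts g) (rcons (edges g) (upair u1 u2)).

Definition pick_prob (R : realType) (g : multigraph) (u : nat) : R :=
  (degree g u)%:R / (total_degree g)%:R.

(* The probability that the next graph is h, given that the current graph is g
   and that the coin of this step shows z.  Distinct choices may lead to the
   same h, such as (u1, u2) and (u2, u1) in an edge-step. *)
Definition step_prob (R : realType) (z : bool) (g h : multigraph) : R :=
  if z then \sum_(u < nverts g) pick_prob R g u * (h == vertex_step g u)%:R
  else \sum_(u1 < nverts g) \sum_(u2 < nverts g)
         pick_prob R g u1 * pick_prob R g u2 * (h == edge_step g u1 u2)%:R.

(* Since the variables are two-valued, the product rule on the events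
   {Z s = z s} amounts to the independence of the generated sigma-algebras. *)
Definition iid_bernoulli (R : realType) (d : measure_display) (T : measurableType d)
    (P : probability T R) (p : R) (Z : nat -> T -> bool) : Prop :=
  [/\ forall t b, (0 < t)%N -> measurable [set w | Z t w = b],
      forall t, (0 < t)%N -> P [set w | Z t w = true] = p%:E
    & forall (J : seq nat) (z : nat -> bool), uniq J -> all (leq 1) J ->
        P [set w | forall s, s \in J -> Z s w = z s] =
        (\prod_(s <- J) P [set w | Z s w = z s])%E].

Definition history (T : Type) (Z : nat -> T -> bool) (G : nat -> T -> multigraph)
    (z : nat -> bool) (g : nat -> multigraph) (t : nat) : set T :=
  [set w | (forall s, (0 < s <= t)%N -> G s w = g s) /\
           (forall s, (0 < s < t)%N -> Z s w = z s)].

(* The times are t >= 1; the values of Z and G at 0 play no role.  The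
   conditional laws are given in product form, so that histories of
   probability 0 need no special treatment: the coin Z t is independent of
   everything before it, and given the past and Z t the law of G (t + 1)
   depends on G t and Z t only, through step_prob. *)
Definition edge_step_PA (R : realType) (d : measure_display) (T : measurableType d)
    (P : probability T R) (p : R) (Z : nat -> T -> bool)
    (G : nat -> T -> multigraph) : Prop :=
  [/\ iid_bernoulli P p Z,
      forall t h, (0 < t)%N -> measurable [set w | G t w = h],
      forall w, G 1%N w = loop_graph,
      forall t z g b, (0 < t)%N ->
        P (history Z G z g t `&` [set w | Z t w = b]) =
        (P (history Z G z g t) * P [set w | Z t w = b])%E
    & forall t z g b h, (0 < t)%N ->
        P (history Z G z g t `&` [set w | Z t w = b] `&`
           [set w | G t.+1 w = h]) =
        (P (history Z G z g t `&` [set w | Z t w = b]) *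
         (step_prob R b (g t) h)%:E)%E].

(* Main.v *)
Require Import Defs.
From mathcomp Require Import all_boot all_order all_algebra.
From mathcomp Require Import all_classical all_reals all_analysis.
From mathcomp Require Import ring lra zify.

(* Fix e <= min(eps, 1/2) and put b = (1 - p)/(2 - p), al = (1 - e) b,
   be = (1 - e/2) b, and ga slightly above 1/2.  Up to probability o(1):
   - at time t^be there are at least 2 t^al vertices, since E[exp(- #vertices)]
     decreases by a constant factor at each step;
   - at time t at least half of the first 2 t^al vertices have degree at least
     t^ga.  The expected degree of a vertex grows by (t / t^be)^(1 - p/2), whose
     exponent in t exceeds ga; the lower tail is controlled by the negative
     moment E[degree^(- sg)] with sg small, which decays almost as fast as the
     power - sg of the expectation.  Each vertex fails with probability at most
     t^(- rho), so by Markov's inequality fewer than half of them fail;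
   - two such vertices stay non-adjacent during the steps t, ..., 2t with
     probability at most exp(- c t^(2 ga - 1)), which beats the number of
     pairs. *)

Import Order.TTheory GRing.Theory Num.Theory.
Import numFieldNormedType.Exports.

Set Implicit Arguments.
Unset Strict Implicit.
Unset Printing Implicit Defensive.

Local Open Scope classical_set_scope.
Local Open Scope ring_scope.

(** * The transition operator, reachable graphs and their total degree *)

(** The Markov operator of the process: the conditional expectation of [f] at the next graph, given
    the current graph [g]. Averaging over the random choices, not over the resulting graphs, avoids
    treating choices with equal outcomes separately. *)
Definition mstep (R : realType) (p : R) (f : multigraph -> R)
    (g : multigraph) : R :=
  p * (\sum_(u < nverts g) pick_prob R g u * f (vertex_step g u)) +
  (1 - p) * (\sum_(u1 < nverts g) \sum_(u2 < nverts g)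
               pick_prob R g u1 * pick_prob R g u2 * f (edge_step g u1 u2)).

Definition mstepn (R : realType) (p : R) n := iter n (@mstep R p).

(** Invariant of the graphs reachable at time [t]. Positivity of the degrees is what allows the
    recursion [phiS] to be applied to them. *)
Definition wf (t : nat) (g : multigraph) : Prop :=
  [/\ (0 < t)%N, size (edges g) = t,
      forall e, e \in edges g -> (e.1 < nverts g)%N /\ (e.2 < nverts g)%N
    & forall v, (v < nverts g)%N -> (0 < degree g v)%N].

Inductive succ (g : multigraph) : multigraph -> Prop :=
| SuccV (u : 'I_(nverts g)) : succ g (vertex_step g u)
| SuccE (u1 u2 : 'I_(nverts g)) : succ g (edge_step g u1 u2).

Lemma upair_lt n u v : (u < n)%N -> (v < n)%N ->
  ((upair u v).1 < n)%N /\ ((upair u v).2 < n)%N.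
Proof. rewrite /upair /=; lia. Qed.

Lemma nverts_succ g h : succ g h -> (nverts g <= nverts h)%N.
Proof. by case=> //= u; rewrite leqnSn. Qed.

Lemma edges_succ g h e : succ g h -> e \in edges g -> e \in edges h.
Proof. by case=> *; rewrite mem_rcons inE; apply/orP; right. Qed.

Lemma degree_rcons n s u v k :
  degree (Multigraph n (rcons s (upair u v))) k =
  (degree (Multigraph n s) k + ((u == k) + (v == k)))%N.
Proof.
rewrite /degree /= -cats1 big_cat big_seq1 /= /upair /=.
by congr addn; rewrite /minn /maxn; case: ifP => _ //; rewrite addnC.
Qed.

Lemma degree_edge_step g u1 u2 k :
  degree (edge_step g u1 u2) k = (degree g k + ((u1 == k) + (u2 == k)))%N.
Proof. exact: degree_rcons. Qed.

Lemma degree_vertex_step g u k : (k < nverts g)%N ->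
  degree (vertex_step g u) k = (degree g k + (u == k))%N.
Proof. by move=> kg; rewrite degree_rcons (gtn_eqF kg) addn0. Qed.

Lemma degree_succ g h k : succ g h -> (degree g k <= degree h k)%N.
Proof. by case=> *; rewrite degree_rcons leq_addr. Qed.

Lemma wf_loop : wf 1 loop_graph.
Proof.
split=> // [e|]; first by rewrite inE => /eqP ->.
by case=> // _; rewrite /degree big_seq1.
Qed.

Lemma wf_succ t g h : wf t g -> succ g h -> wf t.+1 h.
Proof.
move=> [t0 szg inc dg] gh; split=> //.
- by case: gh => *; rewrite size_rcons szg.
- case: gh => [u|u1 u2] e; rewrite mem_rcons inE => /orP[/eqP ->|/inc] //.
  + by apply: upair_lt; rewrite ?ltnS // ltnW.
  + by case=> ? ?; split; rewrite ltnS; apply: ltnW.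
  + exact: upair_lt.
- move=> v vh; have [vg|gv] := ltnP v (nverts g).
    exact: leq_trans (dg v vg) (degree_succ v gh).
  case: gh vh => [u|u1 u2] /=; last by rewrite ltnNge gv.
  rewrite ltnS => vg; rewrite degree_rcons (_ : nverts g == v) ?addn1 ?addnS //.
  by rewrite eqn_leq gv vg.
Qed.

Lemma total_degree_wf t g : wf t g -> total_degree g = (2 * t)%N.
Proof.
case=> _ <- inc _; rewrite /total_degree /degree exchange_big /=.
rewrite -sum1_size big_distrr /= big_seq [RHS]big_seq.
apply: eq_bigr => e /inc[e1 e2]; rewrite big_split /= muln1.
have aux k : (k < nverts g)%N -> (\sum_(v < nverts g) (k == v) = 1)%N.
  move=> kg; rewrite (bigD1 (Ordinal kg)) //= eqxx big1 ?addn0 // => v.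
  by rewrite -val_eqE /= eq_sym => /negbTE ->.
by rewrite !aux.
Qed.

(** * The one-step expectation operator *)

Section Operator.
Context {R : realType}.
Variable p : R.
Hypotheses (hp0 : 0 < p) (hp1 : p < 1).
Implicit Types (f : multigraph -> R) (g h : multigraph).

Lemma pick_prob_ge0 g u : 0 <= pick_prob R g u.
Proof. by rewrite /pick_prob divr_ge0. Qed.

Lemma pick_prob_wf t g u : wf t g ->
  pick_prob R g u = (degree g u)%:R / (2 * t%:R).
Proof. by move=> w; rewrite /pick_prob (total_degree_wf w) natrM. Qed.

Lemma sum_pick_prob t g : wf t g -> \sum_(u < nverts g) pick_prob R g u = 1.
Proof.
move=> w; rewrite /pick_prob -mulr_suml -natr_sum divff //.
by rewrite pnatr_eq0 -/(total_degree g) (total_degree_wf w); case: w; case: t.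
Qed.

Lemma sum_pick_if t g k (F0 F1 : R) : wf t g -> (k < nverts g)%N ->
  \sum_(u < nverts g) pick_prob R g u * (if u == k :> nat then F1 else F0) =
  (1 - pick_prob R g k) * F0 + pick_prob R g k * F1.
Proof.
move=> w kg; rewrite -(sum_pick_prob w) (bigD1 (Ordinal kg)) //= eqxx.
rewrite [in RHS](bigD1 (Ordinal kg)) //= addrC; congr (_ + _).
rewrite addrAC subrr add0r mulr_suml; apply: eq_bigr => u.
by rewrite -val_eqE /= => /negbTE ->.
Qed.

Lemma mstep_le f f' g : (forall h, succ g h -> f h <= f' h) ->
  mstep p f g <= mstep p f' g.
Proof.
move=> le; rewrite /mstep lerD // ler_pM2l ?subr_gt0 //; apply: ler_sum => u _.
  by rewrite ler_wpM2l ?pick_prob_ge0 //; apply: le; constructor.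
apply: ler_sum => v _.
by rewrite ler_wpM2l ?mulr_ge0 ?pick_prob_ge0 //; apply: le; constructor.
Qed.

Lemma mstepD f f' g :
  mstep p (fun h => f h + f' h) g = mstep p f g + mstep p f' g.
Proof.
rewrite /mstep addrACA -!mulrDr -!big_split /=; congr (_ * _ + _ * _).
  by apply: eq_bigr => u _; rewrite mulrDr.
by apply: eq_bigr => u _; rewrite -big_split;
  apply: eq_bigr => v _; rewrite mulrDr.
Qed.

Lemma mstepZ (c : R) f g : mstep p (fun h => c * f h) g = c * mstep p f g.
Proof.
rewrite /mstep mulrDr !(mulrCA c); congr (_ * _ + _ * _).
  by rewrite mulr_sumr; apply: eq_bigr => u _; ring.
rewrite mulr_sumr; apply: eq_bigr => u _.
by rewrite mulr_sumr; apply: eq_bigr => v _; ring.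
Qed.

Lemma mstep_cst t (c : R) g : wf t g -> mstep p (fun=> c) g = c.
Proof.
move=> w; rewrite /mstep -mulr_suml (sum_pick_prob w).
under eq_bigr do rewrite -mulr_suml -mulr_sumr (sum_pick_prob w) mulr1.
by rewrite -mulr_suml (sum_pick_prob w); ring.
Qed.

Section Invariant.
Variable I : nat -> multigraph -> Prop.
Hypothesis I_succ : forall t g h, I t g -> succ g h -> I t.+1 h.

(** Every graph visited from [g] satisfies the invariant, so the values elsewhere do not enter the
    expectation. *)
Lemma mstepn_le n t f f' g : I t g ->
  (forall h, I (t + n)%N h -> f h <= f' h) ->
  mstepn p n f g <= mstepn p n f' g.
Proof.
elim: n t g => [|n IHn] t g Ig le; first by apply: le; rewrite addn0.
apply: mstep_le => h gh; apply: (IHn t.+1); first exact: I_succ gh.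
by move=> h'; rewrite addSnnS; apply: le.
Qed.

(** A multiplicative supermartingale bound. The outermost [mstep] is the earliest step, so the
    induction first bounds the later steps, whose constant factor comes out by linearity. *)
Lemma mstepn_decay n t (a : nat -> R) f g : I t g ->
  (forall s h, (t <= s < t + n)%N -> I s h ->
    mstep p f h <= expR (a s) * f h) ->
  mstepn p n f g <= expR (\sum_(t <= s < t + n) a s) * f g.
Proof.
elim: n t g => [|n IHn] t g Ig dec.
  by rewrite addn0 big_geq // expR0 mul1r.
rewrite big_ltn ?addnS ?ltnS ?leq_addr // expRD -addSn.
apply: (@le_trans _ _
  (mstep p (fun h => expR (\sum_(t.+1 <= s < t.+1 + n) a s) * f h) g)).
  apply: mstep_le => h gh; apply: IHn => [|s k st]; first exact: I_succ gh.
  by apply: dec; lia.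
rewrite mstepZ -[leRHS]mulrA [leRHS]mulrCA ler_pM2l ?expR_gt0 //.
by apply: dec => //; lia.
Qed.

End Invariant.

Lemma mstepnD n f f' g :
  mstepn p n (fun h => f h + f' h) g = mstepn p n f g + mstepn p n f' g.
Proof.
elim: n g => // n IHn g; rewrite /mstepn /= -mstepD; congr mstep.
by apply/funext => h; apply: IHn.
Qed.

Lemma mstepnZ n (c : R) f g :
  mstepn p n (fun h => c * f h) g = c * mstepn p n f g.
Proof.
elim: n g => // n IHn g; rewrite /mstepn /= -mstepZ; congr mstep.
by apply/funext => h; apply: IHn.
Qed.

Lemma mstepn_sum (J : Type) (r : seq J) (Q : pred J) n
    (F : J -> multigraph -> R) g :
  mstepn p n (fun h => \sum_(i <- r | Q i) F i h) g =
  \sum_(i <- r | Q i) mstepn p n (F i) g.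
Proof.
elim: r => [|i r IHr].
  (* Writing zero as a product lets [mstepnZ] apply to any graph, whereas [mstepn_cst] asks for
     [wf]. *)
  transitivity (mstepn p n (fun h => 0 * 0) g).
    by congr mstepn; apply/funext => h; rewrite big_nil mul0r.
  by rewrite mstepnZ mul0r big_nil.
rewrite big_cons -IHr; case: ifP => Qi; last first.
  by congr mstepn; apply/funext => h; rewrite big_cons Qi.
by rewrite -mstepnD; congr mstepn; apply/funext => h; rewrite big_cons Qi.
Qed.

Lemma mstepn_cst n t (c : R) g : wf t g -> mstepn p n (fun=> c) g = c.
Proof.
elim: n t g => // n IHn t g w; rewrite -[RHS](mstep_cst c w).
have E h : succ g h -> mstepn p n (fun=> c) h = c by move=> /(wf_succ w)/IHn.
by apply/le_anti/andP; split; apply: mstep_le => h /E Eh;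
  [rewrite -[leRHS]Eh | rewrite -[leLHS]Eh].
Qed.

End Operator.

(** * Number of vertices and non-adjacency *)

Section Estimates.
Context {R : realType}.
Variable p : R.
Hypotheses (hp0 : 0 < p) (hp1 : p < 1).
Implicit Types (g h : multigraph).

(** Chernoff bound: the indicator is at most [expR (M - nverts)], and each step multiplies the mean
    of [expR (- nverts)] by a factor at most [expR (- (p / 2))]. *)
Lemma nverts_decay n t (M : nat) g : wf t g ->
  mstepn p n (fun h => (nverts h < M)%N%:R) g <= expR (M%:R - p / 2 * n%:R).
Proof.
move=> w; have wf_dec s h : wf s h ->
    mstep p (fun h => expR (- (nverts h)%:R)) h
    <= expR (- (p / 2)) * expR (- (nverts h)%:R).
  move=> wh; rewrite /mstep /= -mulr_suml (sum_pick_prob wh).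
  under [X in _ + _ * X]eq_bigr do
    rewrite -mulr_suml -mulr_sumr (sum_pick_prob wh) mulr1.
  rewrite -mulr_suml (sum_pick_prob wh) !mul1r -natr1 opprD expRD.
  rewrite mulrCA [(1 - p) * _]mulrC -mulrDr mulrC.
  rewrite ler_pM2r ?expR_gt0 // (le_trans _ (expR_ge1Dx _)) //.
  (* With this, the factor [p * expR (-1) + (1 - p)] is at most [1 - p / 2]. *)
  have : expR (-1) <= 2^-1 :> R.
    by rewrite expRN lef_pV2 ?posrE ?expR_gt0 // (le_trans _ (expR_ge1Dx _)).
  by move: hp0 hp1; nra.
apply: (@le_trans _ _
  (mstepn p n (fun h => expR M%:R * expR (- (nverts h)%:R)) g)).
  apply: (mstepn_le hp0 hp1 wf_succ w) => h _; rewrite -expRD.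
  case: ltnP => hM; last exact: expR_ge0.
  by rewrite (le_trans _ (expR_ge1Dx _)) // lerDl subr_ge0 ler_nat ltnW.
rewrite mstepnZ expRD ler_pM2l ?expR_gt0 //.
apply: le_trans (mstepn_decay hp0 hp1 wf_succ w (a := fun=> - (p / 2)) _) _.
  by move=> s h _; apply: wf_dec.
rewrite sumr_const_nat addKn -[- (p / 2) *+ n]mulr_natr mulNr 
  -[leRHS]mulr1 ler_pM2l ?expR_gt0 //.
Qed.

Definition noedge (i j : nat) h : R := (upair i j \notin edges h)%:R.

(** Degrees never decrease and the total degree stays below [2 * (t + n)], so each step joins [i]
    and [j] by an edge-step with at least a fixed probability. *)
Lemma noedge_decay n t (D i j : nat) g : wf t g ->
  (i < nverts g)%N -> (j < nverts g)%N ->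
  (D <= degree g i)%N -> (D <= degree g j)%N ->
  mstepn p n (noedge i j) g
  <= expR (- ((1 - p) * (D%:R / (2 * (t + n)%:R)) ^+ 2) * n%:R).
Proof.
move=> w ig jg iD jD.
pose I s h := [/\ wf s h, (i < nverts h)%N, (j < nverts h)%N &
  (D <= degree h i)%N && (D <= degree h j)%N].
have I_succ s h h' : I s h -> succ h h' -> I s.+1 h'.
  move=> [wh ih jh /andP[iDh jDh]] hh'; split.
  - exact: wf_succ hh'.
  - exact: leq_trans (nverts_succ hh').
  - exact: leq_trans (nverts_succ hh').
  - by rewrite (leq_trans iDh) ?(leq_trans jDh) ?degree_succ.
have Ig : I t g by split=> //; rewrite iD.
set q := _ ^+ 2.
apply: le_trans (mstepn_decay hp0 hp1 I_succ Ig
    (a := fun=> - ((1 - p) * q)) _) _.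
  move=> s h /andP[_ st] [wh ih jh /andP[iDh jDh]].
  (* Edges are never removed: once the pair is joined, [noedge] stays 0. *)
  rewrite {2}/noedge; case: (boolP (_ \in _)) => eh.
    rewrite mulr0 -(mstep_cst p 0 wh); apply: mstep_le => // h' hh'.
    by rewrite /noedge (edges_succ hh' eh).
  rewrite mulr1 (le_trans _ (expR_ge1Dx _)) //.
  have p1 : \sum_(u < nverts h) pick_prob R h u *
      noedge i j (vertex_step h u) <= 1.
    rewrite -(sum_pick_prob (R := R) wh); apply: ler_sum => u _.
    by rewrite ler_piMr ?pick_prob_ge0 // /noedge lern1 leq_b1.
  (* Only the draw [(i, j)] in this order is counted, which costs at most a constant factor. *)
  have p2 : \sum_(u1 < nverts h) \sum_(u2 < nverts h)
       pick_prob R h u1 * pick_prob R h u2 * noedge i j (edge_step h u1 u2)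
       <= 1 - pick_prob R h i * pick_prob R h j.
    apply: (@le_trans _ _ (\sum_(u1 < nverts h) pick_prob R h u1 *
        (if u1 == i :> nat then 1 - pick_prob R h j else 1))); last first.
      by rewrite (sum_pick_if _ _ wh) //; lra.
    apply: ler_sum => u _.
    under eq_bigr do rewrite -mulrA.
    rewrite -mulr_sumr ler_wpM2l ?pick_prob_ge0 //; case: eqP => [ui|_].
      apply: (@le_trans _ _ (\sum_(u2 < nverts h) pick_prob R h u2 *
          (if u2 == j :> nat then 0 else 1))); last first.
        by rewrite (sum_pick_if _ _ wh) //; lra.
      apply: ler_sum => v _; rewrite ler_wpM2l ?pick_prob_ge0 //.
      case: eqP => [vj|_]; last by rewrite /noedge lern1 leq_b1.
      by rewrite /noedge /= mem_rcons inE ui vj eqxx.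
    rewrite -(sum_pick_prob (R := R) wh); apply: ler_sum => v _.
    by rewrite ler_piMr ?pick_prob_ge0 // /noedge lern1 leq_b1.
  have qle : q <= pick_prob R h i * pick_prob R h j.
    rewrite /q expr2 !(pick_prob_wf _ wh).
    have s0 : (0 < s)%N by case: wh.
    have le_frac k : (D <= degree h k)%N ->
        D%:R / (2 * (t + n)%:R) <= (degree h k)%:R / (2 * s%:R) :> R.
      move=> Dk; apply: ler_pM => //; rewrite ?invr_ge0 ?mulr_ge0 ?ler_nat //.
      by rewrite lef_pV2 ?posrE ?mulr_gt0 ?ltr0n ?ler_pM2l ?ler_nat //; lia.
    by apply: ler_pM; rewrite ?divr_ge0 ?mulr_ge0 ?le_frac.
  rewrite /mstep; move: hp0 hp1 p1 p2 qle.
  set A := \sum_(u < _) _; set B := \sum_(u < _) _; set C := _ * _.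
  by move=> *; nra.
rewrite sumr_const_nat addKn mulr_natr -[leRHS]mulr1 ler_pM2l ?expR_gt0 //.
by rewrite /noedge lern1 leq_b1.
Qed.

End Estimates.

(** * Lower tail of the degrees *)

Section Harmonic.
Context {R : realType}.

(** Telescoping of [ln (1 + 1 / j) <= 1 / j]. *)
Lemma harmonic_sum_ge (a b : nat) : (0 < a)%N -> (a <= b)%N ->
  ln b%:R - ln a%:R <= \sum_(a <= j < b) j%:R^-1 :> R.
Proof.
move=> a0 ab; rewrite -(telescope_sumr (fun j => ln j%:R)) //.
apply: ler_sum_nat => j /andP[aj _].
have j0 : (0 : R) < j%:R by rewrite ltr0n; lia.
rewrite -ln_div ?posrE // -natr1 mulrDl divff ?gt_eqF // mul1r.
by apply: le_ln1Dx; rewrite (lt_trans (ltrN10 _)) ?invr_gt0.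
Qed.

(** After the term 1, telescoping of [1 / (j + 1) <= - ln (1 - 1 / (j + 1))]. *)
Lemma harmonic_sum_le (d : nat) : (0 < d)%N ->
  \sum_(1 <= j < d) j%:R^-1 <= 1 + ln d%:R :> R.
Proof.
move=> d0; apply: (@le_trans _ _ (\sum_(1 <= j < d.+1) j%:R^-1)).
  by rewrite big_nat_recr //= lerDl invr_ge0.
rewrite big_ltn // invr1 lerD2l.
have -> : ln d%:R = \sum_(1 <= j < d) (ln j.+1%:R - ln j%:R) :> R.
  by rewrite (telescope_sumr (fun j => ln j%:R)) // ln1 subr0.
rewrite big_add1 /=.
apply: ler_sum_nat => j /andP[j0 _].
have j0' : (0 : R) < j%:R by rewrite ltr0n; lia.
have j1 : (0 : R) < j.+1%:R by rewrite ltr0n.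
have := @le_ln1Dx R (- j.+1%:R^-1).
have -> : 1 - j.+1%:R^-1 = j%:R / j.+1%:R :> R.
  by rewrite -natr1; field; rewrite natr1 gt_eqF.
rewrite ln_div ?posrE // ltrN2 invf_lt1 // ltr1n => /(_ _).
by rewrite ltnS j0 => /(_ isT); rewrite -[X in X <= _ -> _]opprB lerN2.
Qed.

End Harmonic.

(** * Drift of a negative moment of the degree *)

Section DegreeDecay.
Context {R : realType}.
Variables (p sg : R).
Hypotheses (hp0 : 0 < p) (hp1 : p < 1) (sg0 : 0 < sg) (sg1 : sg < 1).
Implicit Types (g h : multigraph).

(* Of order d ^ (- sg); the exact ratio of consecutive values makes the drift
   of phi (degree g k) independent of the degree to first order. *)
Definition phi (d : nat) : R := \prod_(1 <= j < d) (1 - sg / j%:R).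

Lemma phiS d : (0 < d)%N -> phi d.+1 = phi d * (1 - sg / d%:R).
Proof. by move=> d0; rewrite /phi big_nat_recr. Qed.

Lemma phi_factor_ge0 d : (0 < d)%N -> 0 < 1 - sg / d%:R.
Proof.
move=> d0; rewrite subr_gt0 ltr_pdivrMr ?ltr0n // mul1r.
by rewrite (lt_le_trans sg1) // ler1n.
Qed.

Lemma phi_gt0 d : 0 < phi d.
Proof.
by rewrite /phi big_nat_cond prodr_gt0 // => j /andP[/andP[j0 _] _];
  apply: phi_factor_ge0.
Qed.

Lemma phi_nonincr d d' : (0 < d)%N -> (d <= d')%N -> phi d' <= phi d.
Proof.
move=> d0; elim: d' => [|d' IHd]; first by rewrite leqn0 => /eqP ->.
rewrite leq_eqVlt ltnS => /orP[/eqP <- //|dd'].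
rewrite (le_trans _ (IHd dd')) // phiS ?(leq_trans d0) //.
by rewrite ler_piMr ?(ltW (phi_gt0 _)) // gerBl divr_ge0 // ltW.
Qed.

Lemma phi_le1 d : phi d <= 1.
Proof.
case: d => [|d]; first by rewrite /phi big_geq.
by rewrite (le_trans (phi_nonincr (d := 1) _ _)) // /phi big_geq.
Qed.

(** Each factor [1 - y] with [0 < y <= sg] is at least [expR (- (y / (1 - sg)))]; the exponents then
    form a harmonic sum. *)
Lemma phi_ge d : (0 < d)%N ->
  expR (- (sg / (1 - sg) * (1 + ln d%:R))) <= phi d.
Proof.
move=> d0; have sg1' : 0 < 1 - sg by rewrite subr_gt0.
apply: (@le_trans _ _ (expR (\sum_(1 <= j < d) - (sg / (1 - sg) * j%:R^-1)))).
  rewrite ler_expR sumrN lerN2 -mulr_sumr ler_pM2l ?divr_gt0 //.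
  exact: harmonic_sum_le.
rewrite /phi expR_sum big_nat_cond [leRHS]big_nat_cond.
apply: ler_prod => j /andP[/andP[j0 _] _]; rewrite expR_ge0 /= expRN.
set y := sg / j%:R.
have y0 : 0 < y by rewrite divr_gt0 // ltr0n.
have ysg : y <= sg by rewrite ler_pdivrMr ?ltr0n // ler_peMr ?ler1n // ltW.
rewrite -[leLHS]mul1r ler_pdivrMr ?expR_gt0 //.
have -> : sg / (1 - sg) / j%:R = y / (1 - sg) by rewrite /y mulrAC.
(* With [z = y / (1 - sg)] the product [(1 - y) * (1 + z)] equals [1 + z * (sg - y)]. *)
apply: (@le_trans _ _ ((1 - y) * (1 + y / (1 - sg)))).
  set z := _ / _; have yz : y = z * (1 - sg) by rewrite /z divfK // gt_eqF.
  have z0 : 0 < z by rewrite divr_gt0.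
  have : 0 <= z * (sg - y) by rewrite mulr_ge0 ?subr_ge0 // ltW.
  nra.
by rewrite ler_wpM2l ?expR_ge1Dx // subr_ge0 (le_trans ysg) // ltW.
Qed.

(** The exponent of decay in time of the mean of [phi (degree g k)]: [(1 - p / 2) * sg] is the
    first-order rate, and the factor [1 - sg] leaves room for the second-order term. *)
Definition kappa : R := (1 - p / 2) * sg * (1 - sg).

(** An end of a new edge hits [k] with probability [x = d / (2 * s)] and then lowers [phi] by the
    fraction [a = sg / d]; the product [x * a = sg / (2 * s)] is free of [d]. The mean number of
    such ends is [(2 - p) * x], and the correction for an edge-step hitting [k] twice is absorbed
    since [1 / s <= sg]. *)
Lemma phi_drift s k g : wf s g -> (k < nverts g)%N -> 1 <= sg * s%:R ->
  mstep p (fun h => phi (degree h k)) g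
  <= expR (- (kappa / s%:R)) * phi (degree g k).
Proof.
move=> w kg sgs; have d0 : (0 < degree g k)%N by case: w => _ _ _; apply.
set d := degree g k in d0 *; set x := pick_prob R g k.
have s0 : (0 < s)%N by case: w.
have inner a : \sum_(u < nverts g) pick_prob R g u *
      phi (d + (a + (u == k :> nat)))
    = (1 - x) * phi (d + a) + x * phi (d + a).+1.
  rewrite -(sum_pick_if _ _ w kg); apply: eq_bigr => u _; congr (_ * _).
  by case: eqP => _; rewrite ?addn1 ?addn0 ?addnS.
have -> : mstep p (fun h => phi (degree h k)) g =
    p * ((1 - x) * phi d + x * phi d.+1) +
    (1 - p) * ((1 - x) * ((1 - x) * phi d + x * phi d.+1) +
               x * ((1 - x) * phi d.+1 + x * phi d.+2)).
  rewrite /mstep; congr (_ * _ + _ * _).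
    rewrite -[in RHS](addn0 d) -(inner 0); apply: eq_bigr => u _.
    by rewrite degree_vertex_step.
  rewrite -(sum_pick_if _ _ w kg); apply: eq_bigr => u _.
  under eq_bigr do rewrite degree_edge_step -mulrA.
  rewrite -mulr_sumr inner; congr (_ * _).
  by case: eqP => _; rewrite ?addn1 ?addn0.
rewrite !phiS //; set F := phi d; have F0 : 0 < F := phi_gt0 d.
rewrite [leRHS]mulrC; set a := sg / d%:R; set b := sg / d.+1%:R.
set wt := (2 * s%:R)^-1 : R.
have wt0 : 0 < wt by rewrite invr_gt0 mulr_gt0 ?ltr0n.
have xE : x = d%:R * wt by rewrite /x (pick_prob_wf _ w).
have dR : (0 : R) < d%:R by rewrite ltr0n.
have ad : a * d%:R = sg by rewrite /a divfK // gt_eqF.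
have bd : b * (d%:R + 1) = sg by rewrite /b natr1 divfK // gt_eqF // ltr0n.
have b0 : 0 < b by rewrite divr_gt0 ?ltr0n.
have xa : x * a = sg * wt by rewrite xE mulrAC [_ * a]mulrC ad.
(* The parts of order [d] in [a * d ^ 2] and [b * d * (d + 1)] cancel, leaving [(1 + sg) * (d * b)],
   at most [2 * sg]. *)
have xxe : x * x * (a - b + a * b) <= 2 * sg * wt ^+ 2.
  have -> : x * x * (a - b + a * b) =
      wt ^+ 2 * (a * d%:R * d%:R - d%:R * (b * (d%:R + 1)) + d%:R * b
                 + a * d%:R * (d%:R * b)) by rewrite xE; ring.
  rewrite ad bd mulrC ler_pM2r ?exprn_gt0 //.
  have db : d%:R * b <= sg.
    by rewrite -bd [leRHS]mulrC ler_pM2r // lerDl.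
  rewrite [sg * d%:R]mulrC subrr add0r -[X in X + _]mul1r -mulrDl.
  apply: ler_pM => //.
  - by rewrite addr_ge0 // ltW.
  - by rewrite mulr_ge0 // ltW.
  - by move: sg1; lra.
have wsg : 2 * wt <= sg.
  rewrite /wt invfM mulrA divff ?mul1r //.
  by rewrite -[leLHS]mul1r ler_pdivrMr ?ltr0n.
have kE : kappa / s%:R = (2 - p) * sg * (1 - sg) * wt.
  by rewrite /kappa /wt; field; rewrite pnatr_eq0 -lt0n.
apply: (@le_trans _ _ (F * (1 - kappa / s%:R))); last first.
  by rewrite ler_pM2l // expR_ge1Dx.
rewrite [leLHS](_ : _ = F * (1 - (2 - p) * (x * a) +
  (1 - p) * (x * x * (a - b + a * b)))); last by ring.
rewrite ler_pM2l // xa kE.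
have h1 : (1 - p) * (x * x * (a - b + a * b)) <= 2 * sg * wt ^+ 2.
  apply: (le_trans (ler_wpM2l _ xxe)); first by rewrite subr_ge0 ltW.
  rewrite ler_piMl ?mulr_ge0 ?exprn_ge0 // ?(ltW sg0) ?(ltW wt0) //.
  by rewrite gerBl ltW.
have h2 : 2 * sg * wt ^+ 2 <= (2 - p) * sg * sg * wt.
  have -> : 2 * sg * wt ^+ 2 = (sg * wt) * (2 * wt) by ring.
  have -> : (2 - p) * sg * sg * wt = (sg * wt) * ((2 - p) * sg) by ring.
  rewrite ler_pM2l ?mulr_gt0 // (le_trans wsg) // ler_peMl ?(ltW sg0) //.
  by move: hp1; lra.
lra.
Qed.

(** Markov's inequality for [phi (degree h k)]: on low degrees it is at least the bound of [phi_ge]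
    at [D], while its mean starts at most at 1 and decays like the power [- kappa] of
    [(m + n) / m]. *)
Lemma degree_decay n m (D k : nat) g : wf m g -> (k < nverts g)%N ->
  1 <= sg * m%:R -> (0 < D)%N ->
  mstepn p n (fun h => (degree h k < D)%N%:R) g
  <= expR (sg / (1 - sg) * (1 + ln D%:R) - kappa * (ln (m + n)%:R - ln m%:R)).
Proof.
move=> w kg sgm D0.
have m0 : (0 < m)%N by case: w.
pose I s h := [/\ wf s h, (k < nverts h)%N & (m <= s)%N].
have I_succ s h h' : I s h -> succ h h' -> I s.+1 h'.
  move=> [wh kh ms] hh'; split; [exact: wf_succ hh'| |exact: leqW].
  exact: leq_trans (nverts_succ hh').
have Ig : I m g by split.
have k0 : 0 < kappa.
  by rewrite /kappa !mulr_gt0 ?subr_gt0 //; move: hp1; lra.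
set C := expR (sg / (1 - sg) * (1 + ln D%:R)).
apply: (@le_trans _ _ (mstepn p n (fun h => C * phi (degree h k)) g)).
  apply: (mstepn_le hp0 hp1 I_succ Ig) => h [wh kh _].
  case: ltnP => hD; last by rewrite mulr_ge0 ?expR_ge0 // ltW // phi_gt0.
  have dh0 : (0 < degree h k)%N by case: wh => _ _ _; apply.
  rewrite -ler_pdivrMl ?expR_gt0 // mulr1 /C -expRN.
  by rewrite (le_trans (phi_ge D0)) // phi_nonincr // ltnW.
rewrite mstepnZ expRD ler_pM2l ?expR_gt0 //.
apply: le_trans (mstepn_decay hp0 hp1 I_succ Ig
                   (a := fun s => - (kappa / s%:R)) _) _.
  move=> s h /andP[ms _] [wh kh _]; apply: phi_drift => //.
  by rewrite (le_trans sgm) // ler_pM2l // ler_nat.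
apply: (@le_trans _ _ (expR (\sum_(m <= s < m + n) - (kappa / s%:R)))).
  by rewrite ler_piMr ?expR_ge0 // phi_le1.
rewrite ler_expR sumrN lerN2 -mulr_sumr ler_pM2l //.
by rewrite harmonic_sum_ge // leq_addr.
Qed.

End DegreeDecay.

(** * Absence of a clique *)

Section CliqueBound.
Context {R : realType}.
Variables (p sg : R).
Hypotheses (hp0 : 0 < p) (hp1 : p < 1) (sg0 : 0 < sg) (sg1 : sg < 1).
Implicit Types (g h : multigraph).

Definition noclique (K : nat) h : R :=
  (~~ `[< @has_complete_subgraph R h K%:R >])%:R.

Lemma noclique_le1 K h : noclique K h <= 1.
Proof. by rewrite /noclique lern1 leq_b1. Qed.

(** Either some pair of distinct elements of [Q] is not joined and contributes 1 to the sum, or [Q]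
    itself is a complete subgraph of order at least [K]. *)
Lemma noclique_le_sum (K M : nat) (Q : {set 'I_M}) h :
  (M <= nverts h)%N -> (K <= #|Q|)%N ->
  noclique K h <=
  \sum_(i in Q) \sum_(j in Q) (i != j)%:R * noedge i j h.
Proof.
move=> Mh KQ; have term_ge0 (i j : 'I_M) : 0 <= (i != j)%:R * noedge i j h :> R.
  by rewrite mulr_ge0 // /noedge ler0n.
have [/'exists_existsP[i [j /and4P[iQ jQ ij eij]]]|] := boolP
    [exists i, exists j,
      [&& i \in Q, j \in Q, i != j & upair i j \notin edges h]].
  apply: (le_trans (noclique_le1 _ _)).
  rewrite (bigD1 i) //= (bigD1 j) //= ij mul1r {1}/noedge eij.
  by rewrite -addrA lerDl addr_ge0 //; apply: sumr_ge0 => k _ //;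
    apply: sumr_ge0.
rewrite negb_exists => /forallP noij.
rewrite /noclique (_ : `[< _ >]); 
  first by apply: sumr_ge0 => k _; apply: sumr_ge0.
apply/asboolP; exists (widen_ord Mh @: Q); split; last first.
  by rewrite card_imset ?ler_nat // => i j [] /ord_inj.
move=> _ _ /imsetP[i iQ ->] /imsetP[j jQ ->] ij.
have {}ij : i != j by apply: contraNneq ij => ->.
have := noij i; rewrite negb_exists => /forallP/(_ j).
by rewrite iQ jQ ij /= negbK.
Qed.

Lemma noclique_of_degrees n t (K M D : nat) (Q : {set 'I_M}) g : wf t g ->
  (M <= nverts g)%N -> (K <= #|Q|)%N ->
  (forall i, i \in Q -> (D <= degree g i)%N) ->
  mstepn p n (noclique K) g <=
  M%:R ^+ 2 * expR (- ((1 - p) * (D%:R / (2 * (t + n)%:R)) ^+ 2) * n%:R).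
Proof.
move=> w Mg KQ QD; set C := expR _.
pose I s h := wf s h /\ (M <= nverts h)%N.
have I_succ s h h' : I s h -> succ h h' -> I s.+1 h'.
  move=> [wh Mh] hh'; split; first exact: wf_succ hh'.
  exact: leq_trans (nverts_succ hh').
have Ig : I t g by split.
apply: le_trans (mstepn_le hp0 hp1 I_succ Ig
  (fun h Ih => noclique_le_sum Ih.2 KQ)) _.
rewrite mstepn_sum; apply: (@le_trans _ _ (\sum_(i in Q) \sum_(j in Q) C)).
  apply: ler_sum => i iQ; rewrite mstepn_sum; apply: ler_sum => j jQ.
  rewrite mstepnZ; apply: (@le_trans _ _ (1 * mstepn p n (noedge i j) g)).
    apply: ler_wpM2r; last by rewrite lern1 leq_b1.
    rewrite -(mstepn_cst hp0 hp1 n 0 w).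
    apply: (mstepn_le hp0 hp1 wf_succ w) => h _.
    by rewrite /noedge ler0n.
  rewrite mul1r; apply: noedge_decay => //; try exact: QD.
    exact: leq_trans (ltn_ord i) Mg.
  exact: leq_trans (ltn_ord j) Mg.
rewrite !sumr_const -mulrnA -[leLHS]mulr_natl expr2 -natrM.
rewrite ler_pM2r ?expR_gt0 //.
by rewrite ler_nat leq_mul // (leq_trans (max_card _)) // card_ord.
Qed.

(** One error term per phase: enough vertices at time [n0 + 1], high degrees at time [n0 + 1 + n1],
    joined pairs in the last [n2] steps. The outermost iterate is the first phase, so the bounds are
    proved from the last phase backwards. *)
Lemma noclique_bound n0 n1 n2 (K D : nat) : (0 < K)%N -> (0 < D)%N ->
  1 <= sg * n0.+1%:R ->
  mstepn p (n0 + (n1 + n2)) (noclique K) loop_graph <=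
  expR ((2 * K)%:R - p / 2 * n0%:R) +
  2 * expR (sg / (1 - sg) * (1 + ln D%:R) -
            kappa p sg * (ln (n0.+1 + n1)%:R - ln n0.+1%:R)) +
  (2 * K)%:R ^+ 2 *
    expR (- ((1 - p) * (D%:R / (2 * (n0.+1 + n1 + n2)%:R)) ^+ 2) * n2%:R).
Proof.
move=> K0 D0 sgm; set M := (2 * K)%N; set A := expR _; set B := expR _.
set C := _ ^+ 2 * expR _.
rewrite /mstepn iterD iterD -/(mstepn p _) -!/(mstepn p _ _).
(* Pointwise Markov inequality: if fewer than [K] of the [2 * K] vertices have degree at least [D],
   then more than [K] miss it and the second term exceeds 1. *)
have at_t h : wf (n0.+1 + n1) h -> (M <= nverts h)%N ->
    mstepn p n2 (noclique K) h <=
    C + K%:R^-1 * \sum_(k < M) (degree h k < D)%N%:R.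
  move=> wh Mh; pose Q := [set k : 'I_M | (D <= degree h k)%N]%SET.
  have [KQ|QK] := leqP K #|Q|.
    apply: (@le_trans _ _ C).
      by apply: (noclique_of_degrees n2 wh Mh KQ) => k; rewrite inE.
    by rewrite lerDl mulr_ge0 ?invr_ge0 ?sumr_ge0.
  apply: (@le_trans _ _ 1).
    rewrite -(mstepn_cst hp0 hp1 n2 1 wh).
    by apply: (mstepn_le hp0 hp1 wf_succ wh) => h' _; apply: noclique_le1.
  apply: (@le_trans _ _ (K%:R^-1 * \sum_(k < M) (degree h k < D)%N%:R));
    last first.
    by rewrite lerDr /C mulr_ge0 ?expR_ge0 ?exprn_ge0.
  rewrite ler_pdivlMl ?ltr0n // mulr1 -natr_sum ler_nat.
  have -> : (\sum_(k < M) (degree h k < D) = #|~: Q|)%N.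
    rewrite -sum1_card [RHS]big_mkcond /=; apply: eq_bigr => k _.
    by rewrite !inE -ltnNge; case: ltnP.
  have := cardsC Q; rewrite card_ord => cQ; have ME : M = (2 * K)%N by [].
  by clearbody M; lia.
have at_m g : wf n0.+1 g ->
    mstepn p n1 (mstepn p n2 (noclique K)) g <= C + 2 * B + (nverts g < M)%N%:R.
  move=> w; case: ltnP => Mg.
    apply: (@le_trans _ _ 1).
      rewrite -(mstepn_cst hp0 hp1 n1 1 w).
      apply: (mstepn_le hp0 hp1 wf_succ w) => h wh.
      rewrite -(mstepn_cst hp0 hp1 n2 1 wh).
      apply: (mstepn_le hp0 hp1 wf_succ wh) => h' _.
      exact: noclique_le1.
    by rewrite lerDr addr_ge0 ?mulr_ge0 ?expR_ge0 ?exprn_ge0.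
  pose I s h := wf s h /\ (M <= nverts h)%N.
  have I_succ s h h' : I s h -> succ h h' -> I s.+1 h'.
    move=> [wh Mh] hh'; split; first exact: wf_succ hh'.
    exact: leq_trans (nverts_succ hh').
  have Ig : I n0.+1 g by split.
  apply: le_trans (mstepn_le hp0 hp1 I_succ Ig
    (fun h Ih => at_t h Ih.1 Ih.2)) _.
  rewrite mstepnD (mstepn_cst hp0 hp1 n1 C w) mstepnZ mstepn_sum addr0 lerD2l.
  rewrite ler_pdivrMl ?ltr0n //.
  apply: (@le_trans _ _ (\sum_(k < M) B)).
    apply: ler_sum => k _; apply: (degree_decay hp0 hp1 sg0 sg1)=> //.
    exact: leq_trans (ltn_ord k) Mg.
  by rewrite sumr_const card_ord -[leLHS]mulr_natl [leRHS]mulrCA mulrA -natrM.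
apply: le_trans (mstepn_le hp0 hp1 wf_succ wf_loop (fun h wh => at_m h wh)) _.
rewrite mstepnD (mstepn_cst hp0 hp1 n0 _ wf_loop) addrC [C + _]addrC addrA.
rewrite lerD2r lerD2r.
exact: (nverts_decay hp0 hp1 _ _ wf_loop).
Qed.

End CliqueBound.

(** * From the operator to the process *)

Section Transfer.
Context (R : realType) (d : measure_display) (T : measurableType d).
Variable P : probability T R.
Context (p : R) (Z : nat -> T -> bool) (G : nat -> T -> multigraph).
Hypothesis (hG : edge_step_PA P p Z G).
Implicit Types (A B H : set T).

(** Multigraphs form a countable type, so the event is a countable union of measurable fibres. *)
Lemma measurable_graph_event t (Q : multigraph -> Prop) : (0 < t)%N ->
  measurable [set w | Q (G t w)].
Proof.
move=> t0; have [_ mG _ _ _] := hG.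
rewrite (_ : [set w | _] =
  \bigcup_(g : multigraph) (if `[< Q g >] then [set w | G t w = g] else set0)).
  apply: countable_bigcupT_measurable => [|g]; first exact: countableP.
  by case: ifP => _ //; apply: mG.
apply/seteqP; split=> w /=.
  by move=> Qw; exists (G t w) => //; case: asboolP.
by case=> g _; case: asboolP => // Qg /= ->.
Qed.

Lemma measurable_history z g t : measurable (history Z G z g t).
Proof.
have [[mZ _ _] mG _ _ _] := hG.
rewrite (_ : history _ _ _ _ _ =
  (\bigcap_(s in [set s | (0 < s <= t)%N]) [set w | G s w = g s]) `&`
  (\bigcap_(s in [set s | (0 < s < t)%N]) [set w | Z s w = z s])) //.
by apply: measurableI; apply: bigcap_measurableType => s /= /andP[s0 _];
  [apply: mG | apply: mZ].
Qed.

Lemma prob_coin t b : (0 < t)%N ->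
  P [set w | Z t w = b] = (if b then p else 1 - p)%:E.
Proof.
move=> t0; have [[mZ PZ _] _ _ _ _] := hG; case: b; first exact: PZ.
rewrite (_ : [set w | _] = ~` [set w | Z t w = true]).
  by rewrite probability_setC ?PZ //; apply: mZ.
by apply/seteqP; split=> w /=; case: (Z t w).
Qed.

(** Fibres over distinct values are disjoint. As only an inequality is claimed, [s] may miss values
    of [Y]. *)
Lemma sum_measure_fibers_le (X : eqType) (Y : T -> X) (s : seq X) B :
  (forall x, measurable [set w | Y w = x]) -> measurable B -> uniq s ->
  (\sum_(x <- s) P (B `&` [set w | Y w = x]) <= P B)%E.
Proof.
move=> mY; elim: s B => [|x s IHs] B mB; first by rewrite big_nil measure_ge0.
move=> /= /andP[xs us]; rewrite big_cons.
rewrite [leRHS](measureDI P mB (mY x)) addeC leeD2r //.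
apply: le_trans (IHs _ (measurableD mB (mY x)) us).
rewrite big_seq [leRHS]big_seq; apply: lee_sum => y ys.
rewrite le_measure ?inE //; first exact: measurableI.
  by apply: measurableI => //; apply: measurableD.
move=> w [Bw /= Yw]; split=> //; split=> //= Yx.
by move: xs; rewrite -Yx Yw ys.
Qed.

(** Duplicates are removed because [step_prob] already adds up all choices leading to the same
    graph. *)
Definition successors (b : bool) (g : multigraph) : seq multigraph :=
  undup (if b then [seq vertex_step g u | u : 'I_(nverts g)]
         else [seq edge_step g u.1 u.2 | u : 'I_(nverts g) * 'I_(nverts g)]).

Lemma sum_indicator (s : seq multigraph) h (f : multigraph -> R) :
  uniq s -> h \in s -> \sum_(k <- s) (k == h)%:R * f k = f h.
Proof.
move=> us hs; rewrite (bigD1_seq h) //= eqxx mul1r big1 ?addr0 //.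
move=> k /negbTE ->.
by rewrite mul0r.
Qed.

Lemma mstep_successors (f : multigraph -> R) g :
  mstep p f g = \sum_(b <- [:: true; false]) (if b then p else 1 - p) *
    \sum_(h <- successors b g) step_prob R b g h * f h.
Proof.
rewrite !big_cons big_nil addr0 /mstep; congr (_ * _ + _ * _) => /=.
  under [RHS]eq_bigr do rewrite mulr_suml.
  rewrite [RHS]exchange_big /=; apply: eq_bigr => u _.
  under eq_bigr do rewrite -mulrA.
  rewrite -mulr_sumr sum_indicator ?undup_uniq // mem_undup.
  by apply/mapP; exists u; rewrite ?mem_enum.
under [RHS]eq_bigr do rewrite mulr_suml.
rewrite [RHS]exchange_big /=; apply: eq_bigr => u _.
under [RHS]eq_bigr do rewrite mulr_suml.
rewrite [RHS]exchange_big /=; apply: eq_bigr => v _.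
under eq_bigr do rewrite -mulrA.
rewrite -mulr_sumr sum_indicator ?undup_uniq // mem_undup.
by apply/mapP; exists (u, v); rewrite ?mem_enum.
Qed.

(** Induction on [n] for all histories at once: the event is split by the coin at time [s] and the
    next graph, and each piece is a history one step longer whose probability is given by the
    product laws. A lower bound suffices for the theorem. *)
Lemma history_mstepn_le (Q : multigraph -> Prop) n s z g : (0 < s)%N ->
  (P (history Z G z g s) * (mstepn p n (fun h => `[< Q h >]%:R) (g s))%:E <=
   P (history Z G z g s `&` [set w | Q (G (s + n)%N w)]))%E.
Proof.
have [[mZ _ _] mG _ indepZ lawG] := hG.
elim: n s z g => [|n IHn] s z g s0.
  rewrite addn0 /=; case: asboolP => Qg; last by rewrite mule0 measure_ge0.
  rewrite mule1 le_measure ?inE //; first exact: measurable_history.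
    by apply: measurableI;
      [exact: measurable_history|exact: measurable_graph_event].
  by move=> w Hw; split=> //=; rewrite Hw.1 ?s0 /=.
set H := history Z G z g s; set E := [set w | _].
have mH : measurable H := measurable_history z g s.
have mE : measurable E by apply: measurable_graph_event; rewrite addnS.
have fH : P H \is a fin_num by rewrite fin_num_measure.
rewrite [mstepn _ _ _ _]mstep_successors -/(mstepn p n _).
apply: le_trans (sum_measure_fibers_le (s := [:: true; false])
  (fun b => mZ s b s0) (measurableI _ _ mH mE) _) => //.
rewrite -(fineK fH) -EFinM mulr_sumr -sumEFin; apply: lee_sum => b _.
rewrite mulrA mulr_sumr -sumEFin.
have mEb : measurable (H `&` E `&` [set w | Z s w = b]).
  by apply: measurableI; [exact: measurableI|exact: mZ].
apply: le_trans (sum_measure_fibers_le (s := successors b (g s))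
  (fun h => mG s.+1 h isT) mEb (undup_uniq _)).
apply: lee_sum => h _.
(* A history up to time [s + 1] records the graph at [s + 1] but the coins only up to [s]. *)
pose z' r := if r == s then b else z r.
pose g' r := if r == s.+1 then h else g r.
have HE : history Z G z' g' s.+1 =
    H `&` [set w | Z s w = b] `&` [set w | G s.+1 w = h].
  apply/seteqP; split=> w /=.
    move=> [Gw Zw]; split; last by rewrite Gw ?ltnSn // /g' eqxx.
    split; last by rewrite Zw ?s0 ?ltnSn // /z' eqxx.
    split=> r /andP[r0 rs].
      by rewrite Gw /g' ?r0 ?ltnS 1?ltnW // ltn_eqF.
    by rewrite Zw /z' ?r0 ?ltnS 1?ltnW // ltn_eqF.
  move=> [[[Gw Zw] Zb] Gh]; split=> r /andP[r0].
    rewrite leq_eqVlt ltnS /g' => /orP[/eqP ->|rs]; first by rewrite eqxx.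
    by rewrite ltn_eqF ?ltnS // Gw // r0.
  rewrite ltnS leq_eqVlt /z' => /orP[/eqP ->|rs]; first by rewrite eqxx.
  by rewrite ltn_eqF // Zw // r0.
have -> : H `&` E `&` [set w | Z s w = b] `&` [set w | G s.+1 w = h] =
    history Z G z' g' s.+1 `&` [set w | Q (G (s.+1 + n)%N w)].
  rewrite HE addSnnS -/E; apply/seteqP; split=> w /=; tauto.
apply: le_trans (IHn s.+1 z' g' isT).
rewrite HE lawG // indepZ // prob_coin // -(fineK fH) /g' eqxx -!EFinM.
by rewrite lee_fin !mulrA.
Qed.

Lemma prob_mstepn_le (Q : multigraph -> Prop) n :
  ((mstepn p n (fun h => `[< Q h >]%:R) loop_graph)%:E <=
   P [set w | Q (G n.+1 w)])%E.
Proof.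
have [_ _ G1 _ _] := hG.
have := history_mstepn_le Q n (fun=> true) (fun=> loop_graph) (ltn0Sn 0).
rewrite (_ : history _ _ _ _ _ = setT) ?probability_setT ?mul1e ?setTI //.
apply/seteqP; split=> w //= _; split=> r; last by lia.
by move=> r1; rewrite (_ : r = 1%N) ?G1 //; lia.
Qed.

End Transfer.

(** * Asymptotics *)

Section Asymptotics.
Context {R : realType}.
Implicit Types (p sg al be ga eta L : R).

Lemma truncnS_bounds (x : R) : 0 <= x ->
  (Num.truncn x)%:R <= x < (Num.truncn x).+1%:R.
Proof. by move=> x0; rewrite -truncn_ge_nat // leqnn -truncn_le_nat leqnn. Qed.

(** The integer is at most [expR x + 1 <= 2 * expR x <= expR (1 + x)]. *)
Lemma ln_truncnS_le (x : R) : 0 <= x -> ln (Num.truncn (expR x)).+1%:R <= 1 + x.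
Proof.
move=> x0; have /andP[tx _] := truncnS_bounds (expR_ge0 x).
rewrite -[leRHS]expRK ler_ln ?posrE ?expR_gt0 ?ltr0n // expRD -natr1.
have e2 : 2 <= expR 1 :> R by apply: le_trans (expR_ge1Dx _).
have ex : 1 <= expR x by rewrite -expR0 ler_expR.
nra.
Qed.

Lemma noclique_le_expR p sg al be ga (t : nat) (L := ln t%:R) :
  0 < p -> p < 1 -> 0 < sg -> sg < 1 -> 0 <= al -> 0 <= be -> 0 <= ga ->
  (0 < t)%N -> 1 <= sg * expR (be * L) -> 2 * expR (be * L) <= t%:R ->
  mstepn p (2 * t).-1 (noclique (Num.truncn (expR (al * L))).+1) loop_graph <=
  expR (1 + 4 * expR (al * L) - p / 2 * expR (be * L)) +
  2 * expR (2 * (sg / (1 - sg)) + kappa p sg -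
            ((1 - be) * kappa p sg - ga * (sg / (1 - sg))) * L) +
  16 * expR (2 * al * L - (1 - p) / 16 * expR ((2 * ga - 1) * L)).
Proof.
(* From time 1 to time [2 * t]: [n] steps to time [n + 1], then on to time [t], then [t] more. *)
have steps n : (n < t)%N -> ((2 * t).-1 = n + ((t - n.+1) + t))%N.
  by clear; lia.
move=> p0 p1 sg0 sg1 al0 be0 ga0 t0 sgt bet.
have L0 : 0 <= L by rewrite ln_ge0 // ler1n.
have tL : t%:R = expR L by rewrite lnK // posrE ltr0n.
have ge1 x : 0 <= x -> 1 <= expR (x * L).
  by move=> x0; rewrite -expR0 ler_expR mulr_ge0.
set K := (Num.truncn _).+1; pose D := (Num.truncn (expR (ga * L))).+1.
pose n0 := Num.truncn (expR (be * L)).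
have /andP[n0le n0gt] := truncnS_bounds (expR_ge0 (be * L)).
have /andP[Kle _] := truncnS_bounds (expR_ge0 (al * L)).
have /andP[_ Dgt] := truncnS_bounds (expR_ge0 (ga * L)).
have mt : (n0.+1 <= t)%N.
  rewrite -(ler_nat R) -natr1 (le_trans _ bet) //.
  by have := ge1 _ be0; move: n0le; rewrite -/n0; lra.
have kap0 : 0 < kappa p sg by rewrite /kappa !mulr_gt0 ?subr_gt0 //; lra.
have s10 : 0 < sg / (1 - sg) by rewrite divr_gt0 // subr_gt0.
have sgm : 1 <= sg * n0.+1%:R by rewrite (le_trans sgt) // ler_pM2l // ltW.
have K4 : (2 * K)%:R <= 4 * expR (al * L) :> R.
  have KE : K%:R = (Num.truncn (expR (al * L)))%:R + 1 :> R by rewrite natr1.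
  by rewrite natrM KE; have := ge1 _ al0; lra.
rewrite (steps _ mt).
apply: le_trans (noclique_bound p0 p1 sg0 sg1 _ _ (D := D) _ _ sgm) _ => //.
rewrite subnKC // -/L; apply: lerD; first apply: lerD.
- rewrite ler_expR; move: n0gt K4; rewrite -/n0 -natr1.
  set y := expR (be * L); set x := expR (al * L); set n := n0%:R.
  by move=> *; nra.
- rewrite ler_pM2l // ler_expR.
  have lD : ln D%:R <= 1 + ga * L by apply: ln_truncnS_le; rewrite mulr_ge0.
  have lm : ln n0.+1%:R <= 1 + be * L by apply: ln_truncnS_le; rewrite mulr_ge0.
  move: lD lm s10 kap0; set s1 := sg / (1 - sg); set ka := kappa p sg.
  set x := ln D%:R; set y := ln n0.+1%:R => lD lm s10 kap0.
  have h1 : s1 * (1 + x) <= s1 * (2 + ga * L) by rewrite ler_pM2l //; lra.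
  have h2 : ka * (L - (1 + be * L)) <= ka * (L - y) by rewrite ler_pM2l //; lra.
  lra.
- rewrite expRD mulrA; apply: ler_pM; rewrite ?expR_ge0 ?exprn_ge0 //.
    have -> : 16 * expR (2 * al * L) = (4 * expR (al * L)) ^+ 2.
      rewrite exprMn -expRM_natl -natrX; congr (_ * expR _); ring.
    by rewrite lerXn2r ?nnegrE ?mulr_ge0 ?expR_ge0.
  rewrite ler_expR mulNr lerN2 -[leLHS]mulrA -[leRHS]mulrA ler_pM2l ?subr_gt0 //.
  have -> : (2 * ga - 1) * L = 2 * (ga * L) - L by ring.
  rewrite expRB expRM_natl -tL addnn -muln2 natrM.
  have tR : (0 : R) < t%:R by rewrite ltr0n.
  have -> : (D%:R / (2 * (t%:R * 2))) ^+ 2 * t%:R = 16^-1 * (D%:R ^+ 2 / t%:R) :> R.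
    by field; rewrite gt_eqF.
  rewrite ler_pM2l ?invr_gt0 // ler_pM2r ?invr_gt0 //.
  by rewrite lerXn2r ?nnegrE ?expR_ge0 ?ltW.
Qed.

Lemma expR_ge_sqr (x : R) : 0 <= x -> 1 + x ^+ 2 / 2 <= expR x.
Proof. by move=> x0; have := expR_ge1Dxn 1 x0. Qed.

(** Factoring out [y = expR (al * L)] leaves [y * (4 - p / 2 * z)], where [p / 2 * z >= k * L ^+ 2
    >= 5 * L >= 4 + L]. *)
Lemma expR_diff_le p al be L (k := p * (be - al) ^+ 2 / 4) :
  0 < p -> 0 <= al -> al <= be -> 1 <= L -> 5 <= k * L ->
  1 + 4 * expR (al * L) - p / 2 * expR (be * L) <= 1 - L.
Proof.
move=> p0 al0 albe L1 kL; have L0 : 0 <= L by rewrite (le_trans _ L1).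
have -> : expR (be * L) = expR (al * L) * expR ((be - al) * L).
  by rewrite -expRD; congr expR; ring.
have y1 : 1 <= expR (al * L) by rewrite -expR0 ler_expR mulr_ge0.
have := @expR_ge_sqr ((be - al) * L); rewrite mulr_ge0 ?subr_ge0 // => /(_ isT).
set y := expR (al * L) in y1 *; set z := expR _ => zge.
have kz : k * L * L <= p / 2 * z.
  apply: (@le_trans _ _ (p / 2 * (((be - al) * L) ^+ 2 / 2))).
    by rewrite /k le_eqVlt; apply/orP; left; apply/eqP; field.
  by rewrite ler_pM2l ?divr_gt0 //; lra.
have : y * (4 - p / 2 * z) <= y * (- L) by rewrite ler_pM2l; nra.
nra.
Qed.

(** The exponential dominates [k * L ^+ 2], and [k * L ^+ 2 - 2 * L + 1 / k] is a nonnegative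
    multiple of a square. *)
Lemma linear_sub_expR_le (c a eta L : R) : 0 < c -> 0 < eta -> 0 <= L ->
  a <= 1 -> a * L - c * expR (eta * L) <= 2 / (c * eta ^+ 2) - L.
Proof.
move=> c0 eta0 L0 a1; pose k := c * eta ^+ 2 / 2.
have k0 : 0 < k by rewrite divr_gt0 // mulr_gt0 // exprn_gt0.
have -> : 2 / (c * eta ^+ 2) = k^-1 by rewrite /k invf_div.
have := @expR_ge_sqr (eta * L); rewrite mulr_ge0 ?(ltW eta0) // => /(_ isT) ege.
have kL : k * L ^+ 2 <= c * expR (eta * L).
  apply: (@le_trans _ _ (c * ((eta * L) ^+ 2 / 2))).
    by rewrite /k le_eqVlt; apply/orP; left; apply/eqP; field.
  by rewrite ler_pM2l //; lra.
have sq : 0 <= k^-1 * (k * L - 1) ^+ 2.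
  by rewrite mulr_ge0 ?sqr_ge0 // invr_ge0 ltW.
have : k^-1 * (k * L - 1) ^+ 2 = k * L ^+ 2 - 2 * L + k^-1.
  by field; rewrite gt_eqF.
have : a * L <= L by rewrite ler_piMl.
lra.
Qed.

Lemma near_le_ln (x : R) : \forall t \near \oo, x <= ln t%:R.
Proof.
near=> t; have : expR x <= t%:R by near: t; exact: nbhs_infty_ger.
move=> xt; have t0 : 0 < t%:R := lt_le_trans (expR_gt0 x) xt.
by rewrite -[leLHS]expRK ler_ln ?posrE ?expR_gt0.
Unshelve. all: by end_near. Qed.

Lemma cvg_expR_ln (a r : R) : 0 < r ->
  expR (a - r * ln t%:R) @[t --> \oo] --> (0 : R).
Proof.
move=> r0; apply/cvgr0Pnorm_lt => e e0; near=> t.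
rewrite ger0_norm ?expR_ge0 // -[ltRHS]lnK ?posrE // ltr_expR.
have : (a - ln e + 1) / r <= ln t%:R by near: t; exact: near_le_ln.
by rewrite ler_pdivrMr // mulrC; lra.
Unshelve. all: by end_near. Qed.

Lemma noclique_cvg0 p e (al := (1 - e) * ((1 - p) / (2 - p))) :
  0 < p -> p < 1 -> 0 < e -> e <= 2^-1 ->
  mstepn p (2 * t).-1
    (noclique (Num.truncn (expR (al * ln t%:R))).+1) loop_graph
    @[t --> \oo] --> (0 : R).
Proof.
move=> p0 p1 e0 e1; pose be := (1 - e / 2) * ((1 - p) / (2 - p)).
(* [eta] is chosen so that [(1 - p / 2) * (1 - be) = 2^-1 + eta]: the exponent of the expected
   degree exceeds [ga], and [sg] is small enough to preserve the gap. *)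
pose eta := e * (1 - p) / 4; pose ga := 2^-1 + eta / 2; pose sg := eta / 4.
have eta0 : 0 < eta by rewrite /eta !mulr_gt0 ?subr_gt0 ?invr_gt0.
have eta1 : eta <= 4^-1 by rewrite /eta; nra.
have sg0 : 0 < sg by rewrite /sg divr_gt0.
have sg1 : sg < 1 by rewrite /sg; lra.
have p2 : 0 < 2 - p by lra.
set q := (1 - p) / (2 - p) in al be *.
have q0 : 0 < q by rewrite /q divr_gt0 // subr_gt0.
have q2 : q <= 2^-1 by rewrite /q ler_pdivrMr //; lra.
have al0 : 0 <= al by rewrite /al mulr_ge0 ?(ltW q0) //; lra.
have albe : al < be by rewrite /al /be ltr_pM2r //; lra.
have be1 : be <= 2^-1 by rewrite /be; nra.
have al2 : 2 * al <= 1 by lra.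
pose rho := (1 - be) * kappa p sg - ga * (sg / (1 - sg)).
have rho0 : 0 < rho.
  have cbe : (1 - p / 2) * (1 - be) = 2^-1 + eta.
    by rewrite /be /q /eta; field; rewrite gt_eqF.
  (* The sign of [rho] is that of the degree exponent, reduced by [(1 - sg) ^+ 2], minus [ga]. *)
  have -> : rho = sg / (1 - sg) * ((2^-1 + eta) * (1 - sg) ^+ 2 - ga).
    by rewrite -cbe /rho /kappa; field; rewrite gt_eqF // subr_gt0.
  apply: mulr_gt0; first by rewrite divr_gt0 // subr_gt0.
  have sqr : 1 - 2 * sg <= (1 - sg) ^+ 2 by have := sqr_ge0 sg; lra.
  rewrite subr_gt0 (lt_le_trans _ (ler_wpM2l _ sqr)) //; last lra.
  by rewrite /ga /sg; nra.
pose c := (1 - p) / 16; have c0 : 0 < c by rewrite divr_gt0 // subr_gt0.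
pose k := p * (be - al) ^+ 2 / 4.
have k0 : 0 < k by rewrite divr_gt0 // mulr_gt0 // exprn_gt0 // subr_gt0.
pose F t : R := expR (1 - 1 * ln t%:R) +
  2 * expR (2 * (sg / (1 - sg)) + kappa p sg - rho * ln t%:R) +
  16 * expR (2 / (c * eta ^+ 2) - 1 * ln t%:R).
have F0 : F t @[t --> \oo] --> (0 : R).
  rewrite -(addr0 0) -[X in X + _](addr0 0).
  rewrite -[X in _ + X + _](mulr0 2) -[X in _ + _ + X](mulr0 16).
  apply: cvgD; first apply: cvgD.
  - exact: cvg_expR_ln.
  - by apply: cvgMr; apply: cvg_expR_ln.
  - by apply: cvgMr; apply: cvg_expR_ln.
apply: (squeeze_cvgr _ (cvg_cst 0) F0); near=> t; apply/andP; split.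
  rewrite -(mstepn_cst p0 p1 (2 * t).-1 0 wf_loop).
  by apply: (mstepn_le p0 p1 wf_succ wf_loop) => h _; rewrite /noclique ler0n.
have t0 : (0 < t)%N by near: t; exact: nbhs_infty_gt.
have L1 : 1 <= ln t%:R :> R by near: t; exact: near_le_ln.
have Lk : 5 / k <= ln t%:R by near: t; exact: near_le_ln.
have Lb : (sg^-1) / be <= ln t%:R by near: t; exact: near_le_ln.
have L2 : 2 <= ln t%:R :> R by near: t; exact: near_le_ln.
have be0 : 0 < be by rewrite (le_lt_trans al0).
apply: le_trans (noclique_le_expR (be := be) (ga := ga)
  p0 p1 sg0 sg1 al0 _ _ t0 _ _) _.
- exact: ltW.
- by rewrite /ga; lra.
- rewrite -ler_pdivrMl // mulr1 (le_trans _ (expR_ge1Dx _)) //.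
  by move: Lb; rewrite ler_pdivrMr // mulrC; lra.
- rewrite -[leRHS]lnK ?posrE ?ltr0n // -[2](@lnK R) ?posrE // -expRD ler_expR.
  have : ln 2 <= 1 :> R.
    by rewrite -[leRHS]expRK ler_ln ?posrE ?expR_gt0 //
      (le_trans _ (expR_ge1Dx _)).
  move: be1 L2; set L := ln t%:R => be1 L2.
  have : be * L <= 2^-1 * L by rewrite ler_pM2r //; lra.
  lra.
- rewrite /F !mul1r lerD ?lerD2r ?ler_expR //.
    apply: expR_diff_le => //; first exact: ltW.
    by move: Lk; rewrite ler_pdivrMr // mulrC.
  rewrite ler_pM2l // ler_expR.
  have -> : 2 * ga - 1 = eta by rewrite /ga; field.
  by apply: linear_sub_expR_le => //; lra.
Unshelve. all: by end_near. Qed.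

End Asymptotics.

(** * Convergence of the probability to 1 *)

Theorem theorem1 (R : realType) (d : measure_display) (T : measurableType d)
    (P : probability T R) (p : R) (hp0 : 0 < p) (hp1 : p < 1)
    (Z : nat -> T -> bool) (G : nat -> T -> multigraph)
    (hG : edge_step_PA P p Z G) (eps : R) (heps : 0 < eps) :
  P [set w | has_complete_subgraph (G (2 * t)%N w)
               (t%:R `^ ((1 - eps) * ((1 - p) / (2 - p))))] @[t --> \oo]
    --> (1 : \bar R)%E.
Proof.
(* Lowering [eps] only raises the required order, so [e <= 2^-1] may be assumed. *)
pose e : R := Num.min eps 2^-1.
have e0 : 0 < e by rewrite lt_min heps invr_gt0 ltr0n.
have e1 : e <= 2^-1 by rewrite /e ge_min lexx orbT.
have e2 : e <= eps by rewrite /e ge_min lexx.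
have F0 := noclique_cvg0 hp0 hp1 e0 e1.
pose al := (1 - e) * ((1 - p) / (2 - p)).
pose K t := (Num.truncn (expR (al * ln (t%:R : R)))).+1.
pose F t : R := mstepn p (2 * t).-1 (noclique (K t)) loop_graph.
have F1 : (1 - F t)%:E @[t --> \oo] --> (1 : \bar R)%E.
  apply: cvg_EFin; first exact: nearW.
  by rewrite -[X in _ --> X]subr0; apply: cvgB; [exact: cvg_cst|exact: F0].
apply: (squeeze_cvge _ F1 (cvg_cst _)); near=> t.
have t0 : (0 < t)%N by near: t; exact: nbhs_infty_gt.
have t2 : (0 < 2 * t)%N by rewrite muln_gt0.
have mE (x : R) : measurable [set w | has_complete_subgraph (G (2 * t)%N w) x].
  exact: (measurable_graph_event hG (fun g => has_complete_subgraph g x)).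
apply/andP; split; last exact: probability_le1.
(* By linearity, [1 - F t] is the mean of the indicator that the complete subgraph exists. *)
have -> : 1 - F t = mstepn p (2 * t).-1
    (fun h => `[< has_complete_subgraph h ((K t)%:R : R) >]%:R) loop_graph.
  apply/eqP; rewrite subr_eq /F -mstepnD; apply/eqP.
  rewrite -[LHS](mstepn_cst hp0 hp1 (2 * t).-1 1 wf_loop); congr mstepn.
  by apply/funext => h; rewrite /noclique; case: `[< _ >];
    rewrite ?addr0 ?add0r.
apply: le_trans (prob_mstepn_le hG _ _) _.
rewrite prednK // le_measure ?inE //.
move=> w [S [cS KS]]; exists S; split=> //; apply: le_trans KS.
have tR : (0 : R) < t%:R by rewrite ltr0n.
rewrite /powR gt_eqF //.
(* [K t] exceeds [t] to the power [al], which for [t >= 1] is at least the power with [eps]. *)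
have /andP[_ /ltW] := truncnS_bounds (expR_ge0 (al * ln (t%:R : R))).
apply: le_trans; rewrite ler_expR ler_wpM2r ?ln_ge0 ?ler1n //.
by rewrite ler_wpM2r ?divr_ge0 ?lerB //; lra.
Unshelve. all: by end_near. Qed.
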